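(* Assume the following. (A1) For every $\omega_0\in\Omega_0$, the function $c(\omega_0,u^i,\frac1N\sum_{p=1}^N u^p)$ is $\mathbb{R}_+$-valued, jointly convex in its second and third arguments, and differentiable in $u^i$ with continuous partial derivatives. (A2) The policy $\underline\gamma^*=(\gamma^{1*},\gamma^{2*},\dots)\in\mathbf{\Gamma}$ satisfies $$\lim_{N\to\infty}\frac1N\sum_{i=1}^N \mathbb{E}^{\underline\gamma^*}\Big[c\big(\omega_0,u^i,\tfrac1N\sum_{p=1}^N u^p\big)\Big]<\infty$$ (in particular the limit exists). If for all $\underline\gamma\in\mathbf{\Gamma}$ with $J(\underline\gamma)<\infty$, $$\limsup_{N\to\infty}\frac1N\,\mathbb{E}\Big[\sum_{i=1}^N\sum_{k=1}^N c_{u^k}(\omega_0,\gamma^{i*},\mu_N^* )\,(\gamma^k-\gamma^{k*})\Big]\ge 0,$$ where $\mu_N^*=\frac1N\sum_{p=1}^N\gamma^{p*}(v^p)$, then $\underline\gamma^*$ is a globally optimal team policy for $(\mathcal{P}_\infty)$.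
   Context: Setting. All random variables live on a probability space $(\Omega,\mathcal{F},\mathbb{P})$; $n,m$ are positive integers. For each $i\in\mathbb{N}$, decision maker $i$ (DM$^i$) observes an $\mathbb{R}^m$-valued random variable $v^i$, which is not affected by the action of any decision maker (the team is static), and applies the action $u^i=\gamma^i(v^i)$ in the action space $\mathbb{U}^i=\mathbb{R}^n$. $\Gamma^i$ is the set of admissible policies of DM$^i$, i.e. measurable functions $\gamma^i:\mathbb{R}^m\to\mathbb{U}^i$, and $\mathbf{\Gamma}=\prod_{i\in\mathbb{N}}\Gamma^i$. $\omega_0$ is an exogenous $\Omega_0$-valued random variable and $c:\Omega_0\times\mathbb{R}^n\times\mathbb{R}^n\to\mathbb{R}_+$ is a Borel measurable cost function. Problem $(\mathcal{P}_\infty)$: for $\underline\gamma=(\gamma^1,\gamma^2,\dots)\in\mathbf{\Gamma}$, $$J(\underline\gamma)=\limsup_{N\to\infty}\frac1N\mathbb{E}^{\underline\gamma}\Big[\sum_{i=1}^N c\big(\omega_0,u^i,\tfrac1N\sum_{p=1}^N u^p\big)\Big],$$ where $\mathbb{E}^{\underline\gamma}[\cdot]$ means that $u^i=\gamma^i(v^i)$ is substituted for all $i$. A policy $\underline\gamma^*\in\mathbf{\Gamma}$ is (globally, team) optimal for $(\mathcal{P}_\infty)$ if $J(\underline\gamma^* )=\inf_{\underline\gamma\in\mathbf{\Gamma}}J(\underline\gamma)$. Differentiability of the cost in $u^i$ means total differentiability: with $\mu_N=\frac1N\sum_{p=1}^N u^p$, $\frac{d}{du^i}c(\omega_0,u^i,\mu_N)=\frac{\partial}{\partial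 u^i}c(\omega_0,u^i,\mu_N)+\frac1N\frac{\partial}{\partial\mu_N}c(\omega_0,u^i,\mu_N)$. The symbol $c_{u^k}(\omega_0,\gamma^{i*},\mu_N^* )$ denotes the derivative with respect to $u^k$ of $(u^1,\dots,u^N)\mapsto c(\omega_0,u^i,\frac1N\sum_{p=1}^N u^p)$ evaluated at $u^p=\gamma^{p*}(v^p)$, $p=1,\dots,N$. Inside the expectation, $\gamma^k$ and $\gamma^{k*}$ abbreviate $\gamma^k(v^k)$ and $\gamma^{k*}(v^k)$, and the product is the pairing of the derivative with the vector $\gamma^k(v^k)-\gamma^{k*}(v^k)$. *)

(* Defs.v *)
From mathcomp Require Import all_boot all_order all_algebra.
From mathcomp Require Import all_classical all_reals all_analysis.

Set Implicit Arguments.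
Unset Strict Implicit.
Unset Printing Implicit Defensive.

Import Order.TTheory GRing.Theory Num.Theory.
Import numFieldNormedType.Exports.

Local Open Scope classical_set_scope.
Local Open Scope ring_scope.

(* R^n with its Borel sigma-algebra; its carrier is convertible to 'rV[R]_n. *)
Definition borel_rV (R : realType) (n : nat) :
    measurableType (@open 'rV[R]_n).-sigma :=
  g_sigma_algebraType (@open 'rV[R]_n).

Definition mean_field (R : realType) (n N : nat) (u : 'I_N -> 'rV[R]_n) :
    'rV[R]_n :=
  N%:R^-1 *: \sum_(p < N) u p.

(* c(w0, u^i, mu_N) as a function of the whole profile (u^1, ..., u^N). *)
Definition agent_cost (Omega0 : Type) (R : realType) (n : nat)
    (c : Omega0 -> 'rV[R]_n -> 'rV[R]_n -> R) (w0 : Omega0)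
    (N : nat) (i : 'I_N) (u : 'I_N -> 'rV[R]_n) : R :=
  c w0 (u i) (mean_field u).

Definition set_action (R : realType) (n N : nat) (u : 'I_N -> 'rV[R]_n)
    (k : 'I_N) (x : 'rV[R]_n) : 'I_N -> 'rV[R]_n :=
  fun p => if p == k then x else u p.

(* c_{u^k}(w0, u^i, mu_N), as a linear form on R^n: x = u^k enters through the
   mean mu_N, and also through the own action when k = i. *)
Definition agent_cost_deriv (Omega0 : Type) (R : realType) (n : nat)
    (c : Omega0 -> 'rV[R]_n -> 'rV[R]_n -> R) (w0 : Omega0)
    (N : nat) (i k : 'I_N) (u : 'I_N -> 'rV[R]_n) : 'rV[R]_n -> R :=
  'd (fun x : 'rV[R]_n => agent_cost c w0 i (set_action u k x) : R^o) (u k).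

Definition cost_du (Omega0 : Type) (R : realType) (n : nat)
    (c : Omega0 -> 'rV[R]_n -> 'rV[R]_n -> R) (w0 : Omega0)
    (x mu : 'rV[R]_n) : 'rV[R]_n -> R :=
  'd (fun y : 'rV[R]_n => c w0 y mu : R^o) x.

Definition cost_dmu (Omega0 : Type) (R : realType) (n : nat)
    (c : Omega0 -> 'rV[R]_n -> 'rV[R]_n -> R) (w0 : Omega0)
    (x mu : 'rV[R]_n) : 'rV[R]_n -> R :=
  'd (fun nu : 'rV[R]_n => c w0 x nu : R^o) mu.

(* Differentiability in u^i is total: the partial derivatives of c in its
   second and third arguments exist, and
   d/du^i c(w0, u^i, mu_N) = d_u c(w0, u^i, mu_N) + 1/N d_mu c(w0, u^i, mu_N),
   for every N, i and profile. *)
Definition totally_differentiable (Omega0 : Type) (R : realType) (n : nat)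
    (c : Omega0 -> 'rV[R]_n -> 'rV[R]_n -> R) (w0 : Omega0) : Prop :=
  [/\ forall x mu : 'rV[R]_n,
        differentiable (fun y : 'rV[R]_n => c w0 y mu : R^o) x,
      forall x mu : 'rV[R]_n,
        differentiable (fun nu : 'rV[R]_n => c w0 x nu : R^o) mu
    & forall (N : nat) (i : 'I_N) (u : 'I_N -> 'rV[R]_n),
        is_diff (u i)
          (fun x : 'rV[R]_n => agent_cost c w0 i (set_action u i x) : R^o)
          (fun h : 'rV[R]_n => cost_du c w0 (u i) (mean_field u) h
             + N%:R^-1 * cost_dmu c w0 (u i) (mean_field u) h)].

Definition continuous_partials (Omega0 : Type) (R : realType) (n : nat)
    (c : Omega0 -> 'rV[R]_n -> 'rV[R]_n -> R) (w0 : Omega0) : Prop :=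
  forall h : 'rV[R]_n,
    continuous (fun z : 'rV[R]_n * 'rV[R]_n => cost_du c w0 z.1 z.2 h) /\
    continuous (fun z : 'rV[R]_n * 'rV[R]_n => cost_dmu c w0 z.1 z.2 h).

Definition jointly_convex (Omega0 : Type) (R : realType) (n : nat)
    (c : Omega0 -> 'rV[R]_n -> 'rV[R]_n -> R) (w0 : Omega0) : Prop :=
  @convex_function R ('rV[R]_n * 'rV[R]_n)%type setT
    (fun z : 'rV[R]_n * 'rV[R]_n => c w0 z.1 z.2).

Definition policies (R : realType) (m n : nat) :
    set (nat -> borel_rV R m -> borel_rV R n) :=
  [set g | forall i, measurable_fun setT (g i)].

(* The decision makers are numbered from 0, so those of the N-agent problem
   are the elements of 'I_N. *)
Definition actions (d : measure_display) (Omega : measurableType d)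
    (R : realType) (P : probability Omega R) (m n : nat)
    (v : nat -> {RV P >-> borel_rV R m})
    (g : nat -> borel_rV R m -> borel_rV R n) (N : nat) (t : Omega) :
    'I_N -> 'rV[R]_n :=
  fun p => g p (v p t).

(* The average cost of the N-agent problem; the value at N = 0 is a dummy, which
   limits along N do not see. *)
Definition J_N (d : measure_display) (Omega : measurableType d)
    (R : realType) (P : probability Omega R)
    (d0 : measure_display) (Omega0 : measurableType d0)
    (w0 : {RV P >-> Omega0}) (m n : nat)
    (v : nat -> {RV P >-> borel_rV R m})
    (c : Omega0 -> 'rV[R]_n -> 'rV[R]_n -> R)
    (g : nat -> borel_rV R m -> borel_rV R n) (N : nat) : \bar R :=
  ((N%:R^-1)%:E *
   'E_P[fun t => (\sum_(i < N) agent_cost c (w0 t) i (actions v g t))%R])%E.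

Definition J (d : measure_display) (Omega : measurableType d)
    (R : realType) (P : probability Omega R)
    (d0 : measure_display) (Omega0 : measurableType d0)
    (w0 : {RV P >-> Omega0}) (m n : nat)
    (v : nat -> {RV P >-> borel_rV R m})
    (c : Omega0 -> 'rV[R]_n -> 'rV[R]_n -> R)
    (g : nat -> borel_rV R m -> borel_rV R n) : \bar R :=
  limn_esup (J_N w0 v c g).

Definition globally_optimal (d : measure_display) (Omega : measurableType d)
    (R : realType) (P : probability Omega R)
    (d0 : measure_display) (Omega0 : measurableType d0)
    (w0 : {RV P >-> Omega0}) (m n : nat)
    (v : nat -> {RV P >-> borel_rV R m})
    (c : Omega0 -> 'rV[R]_n -> 'rV[R]_n -> R)
    (g : nat -> borel_rV R m -> borel_rV R n) : Prop :=
  policies g /\ J w0 v c g = ereal_inf (J w0 v c @` @policies R m n).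

(* Main.v *)
Require Import Defs.
From mathcomp Require Import all_boot all_order all_algebra.
From mathcomp Require Import all_classical all_reals all_analysis.
From mathcomp Require Import measurable_realfun.
From mathcomp Require Import lra.
Import Order.TTheory GRing.Theory Num.Theory.
Import numFieldNormedType.Exports.
Local Open Scope classical_set_scope.
Local Open Scope ring_scope.

(** A differentiable convex function lies above its tangents. Applied to each
    agent's cost at the profile of [gs], in the direction of the profile of a
    competitor [g], this reads, for every scenario and every [N]:
<<
      sum_i cost_i(g)
        >= sum_i cost_i(gs) + sum_i sum_k d_k cost_i(gs) (g_k - gs_k)
>>
    ([agent_cost_first_order]). Taking expectations and dividing by [N] bounds
    the variational term of the [N]-agent problem by [J_N g - J_N gs]
    ([J_N_variation]). Since [J_N gs] converges to a finite limit [l], a limsup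
    of [J_N g] smaller than [l] would keep these differences below a negative
    constant for large [N], against the variational inequality
    ([le_limn_esup_of_variation]). A competitor with infinite cost needs no
    argument.

    Two points need care.

    - The derivatives that occur are the partial derivatives of the cost in its
      own-action and mean-action arguments. Rather than deducing joint
      differentiability from their continuity, the tangent inequality is
      obtained by moving one argument at a time
      ([jointly_convex_first_order]).

    - Nothing is known about the integrability of the variational term. The
      integral is a difference of two suprema over simple functions, hence it is
      monotone for arbitrary functions ([le_integralT]), and it suffices that
      the dominating difference of costs be integrable. That in turn requires
      the costs to be measurable, hence the mean action to be measurable for the
      Borel sigma-algebra of [R^n] ([borel_rV_coordP]). *)

(** * Tangent inequalities for convex functions *)

(** Convexity bounds the difference quotients of step [s < 1] along [h] by the
    difference quotient of step 1; let [s] decrease to 0. *)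
Lemma convex_first_order (R : realType) (V : normedModType R) (f : V -> R)
    (x h : V) :
  (forall s : R, 0 < s -> s < 1 ->
     f (x + s *: h) <= (1 - s) * f x + s * f (x + h)) ->
  differentiable (f : V -> R^o) x ->
  f x + 'd (f : V -> R^o) x h <= f (x + h).
Proof.
move=> fconv df; rewrite -lerBrDl -deriveE//.
have dfh : (fun s : R => s^-1 * (f (s *: h + x) - f x)) @ 0^'+
    --> 'D_h (f : V -> R^o) x.
  have dfh : derivable (f : V -> R^o) x h by exact: diff_derivable.
  apply: cvg_trans dfh; apply: cvg_app; apply: within_subset => t /=.
  by rewrite lt_neqAle eq_sym => /andP[].
rewrite -(cvg_lim _ dfh)//.
apply: limr_le; first by apply/cvg_ex; eexists; exact: dfh.
near=> s.
have s0 : 0 < s by [].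
have s1 : s < 1 by near: s; exact: nbhs_right_lt.
rewrite ler_pdivrMl// [s *: h + x]addrC.
have := fconv s s0 s1; lra.
Unshelve. all: by end_near. Qed.

Section agent_cost_tangent.
Context (R : realType) (Omega0 : Type) (n : nat)
  (c : Omega0 -> 'rV[R]_n -> 'rV[R]_n -> R) (w : Omega0).

Lemma jointly_convex_line (x mu h k : 'rV[R]_n) (s : R) :
  jointly_convex c w -> 0 < s -> s < 1 ->
  c w (x + s *: h) (mu + s *: k) <=
    (1 - s) * c w x mu + s * c w (x + h) (mu + k).
Proof.
move=> cconv s0 s1.
have s01 : (Itv.spec (@Itv.num_sem R) (Itv.Real `[0, 1]%Z) s).
  by rewrite /= /Itv.num_sem num_real/= in_itv/= (ltW s0) (ltW s1).
have := cconv (Itv.mk s01) (x + h, mu + k) (x, mu).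
rewrite !inE => /(_ Logic.I Logic.I).
have conv (a b : 'rV[R]_n) : s *: (a + b) + (1 - s) *: a = a + s *: b.
  by rewrite scalerDr addrAC -scalerDl addrC subrKC scale1r addrC.
rewrite -(conv x h) -(conv mu k) [X in _ <= X]addrC.
exact.
Qed.

(** Move the second argument of the cost from the point reached after moving the
    first one by [s *: h]: the two one-variable tangent inequalities and
    convexity on the segment give the bound with the partial derivative
    [cost_dmu] taken at [x + s *: h], and the continuity of that derivative
    brings it back to [x] as [s] decreases to 0. *)
Lemma jointly_convex_first_order (x mu h k : 'rV[R]_n) :
  jointly_convex c w -> totally_differentiable c w -> continuous_partials c w ->
  c w x mu + (cost_du c w x mu h + cost_dmu c w x mu k)
    <= c w (x + h) (mu + k).
Proof.
move=> cconv [du dmu _] cpart.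
have slope (s : R) : 0 < s -> s < 1 ->
    c w x mu + (cost_du c w x mu h + cost_dmu c w (x + s *: h) mu k)
      <= c w (x + h) (mu + k).
  move=> s0 s1; rewrite -(ler_pM2l s0).
  have hu : c w x mu + s * cost_du c w x mu h <= c w (x + s *: h) mu.
    have -> : s * cost_du c w x mu h = cost_du c w x mu (s *: h).
      by rewrite /cost_du linearZ.
    apply: (@convex_first_order R _ (c w ^~ mu)) => // t t0 t1.
    have := jointly_convex_line x mu (s *: h) 0 t cconv t0 t1.
    by rewrite scaler0 !addr0.
  have hmu : c w (x + s *: h) mu + s * cost_dmu c w (x + s *: h) mu k
      <= c w (x + s *: h) (mu + s *: k).
    have -> : s * cost_dmu c w (x + s *: h) mu k =
        cost_dmu c w (x + s *: h) mu (s *: k) by rewrite /cost_dmu linearZ.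
    apply: (@convex_first_order R _ (c w (x + s *: h))) => // t t0 t1.
    have := jointly_convex_line (x + s *: h) mu 0 (s *: k) t cconv t0 t1.
    by rewrite scaler0 !addr0.
  have := jointly_convex_line x mu h k s cconv s0 s1; lra.
have ccont : (fun s : R => c w x mu
      + (cost_du c w x mu h + cost_dmu c w (x + s *: h) mu k)) @ 0^'+
    --> c w x mu + (cost_du c w x mu h + cost_dmu c w x mu k).
  apply: cvgD; first exact: cvg_cst.
  apply: cvgD; first exact: cvg_cst.
  have -> : cost_dmu c w x mu k = cost_dmu c w (x + (0 : R) *: h) mu k.
    by rewrite scale0r addr0.
  apply: cvg_at_right_filter.
  have xcont : (fun s : R => x + s *: h) @ (0 : R) --> x + (0 : R) *: h.
    by apply: cvgD; [exact: cvg_cst|exact: scalel_continuous].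
  exact: (cvg_comp _ _ (cvg_pair xcont (cvg_cst mu))
    ((cpart k).2 (x + (0 : R) *: h, mu))).
rewrite -(cvg_lim _ ccont)//.
apply: limr_le; first by apply/cvg_ex; eexists; exact: ccont.
near=> s; apply: slope => //; near: s; exact: nbhs_right_lt.
Unshelve. all: by end_near. Qed.

Lemma mean_field_set_action (N : nat) (u : 'I_N -> 'rV[R]_n) (k : 'I_N) x :
  mean_field (set_action u k x) =
  N%:R^-1 *: x + N%:R^-1 *: \sum_(p < N | p != k) u p.
Proof.
rewrite /mean_field (bigD1 k)//= {1}/set_action eqxx scalerDr.
congr (_ + _ *: _).
by apply: eq_bigr => p /negbTE; rewrite /set_action => ->.
Qed.

Lemma set_action_id (N : nat) (u : 'I_N -> 'rV[R]_n) (k : 'I_N) :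
  set_action u k (u k) = u.
Proof. by apply/funext => p; rewrite /set_action; case: eqP => [->|]. Qed.

(** When [k] differs from [i], the action of [k] enters the cost of [i] through
    the mean alone, which is affine in that action with slope [1 / N]. *)
Lemma agent_cost_derivE (N : nat) (i k : 'I_N) (u : 'I_N -> 'rV[R]_n) h :
  totally_differentiable c w ->
  agent_cost_deriv c w i k u h =
  (if k == i then cost_du c w (u i) (mean_field u) h else 0)
  + N%:R^-1 * cost_dmu c w (u i) (mean_field u) h.
Proof.
move=> [du dmu dtot]; case: eqVneq => [->|ki].
  by rewrite /agent_cost_deriv; have dval := dtot N i u; rewrite diff_val.
rewrite add0r /agent_cost_deriv.
pose g : 'rV[R]_n -> 'rV[R]_n :=
  N%:R^-1 *: (id : 'rV[R]_n -> 'rV[R]_n)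
  + cst (N%:R^-1 *: \sum_(p < N | p != k) u p).
have gE x : g x = mean_field (set_action u k x).
  by rewrite mean_field_set_action.
have dg : is_diff (u k) g (N%:R^-1 *: (id : 'rV[R]_n -> 'rV[R]_n) + 0).
  exact: is_diffD.
have -> : (fun x => agent_cost c w i (set_action u k x) : R^o)
    = (fun nu => c w (u i) nu : R^o) \o g.
  apply/funext => x; rewrite /agent_cost /= gE /set_action.
  by rewrite eq_sym (negbTE ki).
have dgu : differentiable g (u k) by [].
rewrite (diff_comp dgu (dmu (u i) (g (u k)))) /=.
rewrite diff_val gE set_action_id /=.
have -> : (N%:R^-1 *: (id : 'rV[R]_n -> 'rV[R]_n) + 0) h = N%:R^-1 *: h.
  by rewrite addr0.
by rewrite /cost_dmu linearZ.
Qed.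

(** Summed over [k], the derivatives in the individual actions make up the
    derivative of [c] along the joint displacement of the own action and of the
    mean. *)
Lemma sum_agent_cost_deriv (N : nat) (i : 'I_N) (u h : 'I_N -> 'rV[R]_n) :
  totally_differentiable c w ->
  \sum_(k < N) agent_cost_deriv c w i k u (h k) =
  cost_du c w (u i) (mean_field u) (h i)
  + cost_dmu c w (u i) (mean_field u) (mean_field h).
Proof.
move=> dc; rewrite (eq_bigr _ (fun k _ => agent_cost_derivE N i k u (h k) dc)).
rewrite big_split/= -big_mkcond/= big_pred1_eq; congr (_ + _).
by rewrite -mulr_sumr [in RHS]/mean_field {2}/cost_dmu linearZ linear_sum.
Qed.

Lemma agent_cost_first_order (N : nat) (i : 'I_N) (u u' : 'I_N -> 'rV[R]_n) :
  jointly_convex c w -> totally_differentiable c w -> continuous_partials c w ->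
  agent_cost c w i u + \sum_(k < N) agent_cost_deriv c w i k u (u' k - u k)
    <= agent_cost c w i u'.
Proof.
move=> cconv cdiff cpart.
rewrite (sum_agent_cost_deriv N i u (fun k => u' k - u k))//.
have -> : agent_cost c w i u' = c w (u i + (u' i - u i))
    (mean_field u + mean_field (fun k => u' k - u k)).
  rewrite /mean_field -scalerDr -big_split/=.
  rewrite /agent_cost addrC subrK; congr (c w _ (_ *: _)).
  by apply: eq_bigr => p _; rewrite addrC subrK.
exact: jointly_convex_first_order.
Qed.
End agent_cost_tangent.

(** * Measurability in R^n *)

(** The sup-norm balls with rational centre and radius form a countable base of
    [R^n], and the preimage of such a ball is a finite intersection of
    conditions on single coordinates. *)
Lemma borel_rV_coordP (R : realType) (n : nat) (d : measure_display)
    (T : measurableType d) (f : T -> borel_rV R n) :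
  (forall j, measurable_fun setT (fun t => (f t : 'rV[R]_n) ord0 j)) ->
  measurable_fun setT f.
Proof.
move=> fj.
apply: (@measurability _ _ T (borel_rV R n) setT f (@open 'rV[R]_n)) => //.
move=> _ [U Uo <-]; rewrite setTI.
pose box (b : 'rV[rat]_n * rat) := [set t |
  forall j, `|(f t : 'rV[R]_n) ord0 j - ratr (b.1 ord0 j)| < ratr b.2].
rewrite [X in measurable X](_ : _ =
    \bigcup_b (if `[< box b `<=` f @^-1` U >] then box b else set0)).
  apply: countable_bigcupT_measurable => // b; case: ifP => // _.
  rewrite (_ : box b = \bigcap_j [set t |
      `|(f t : 'rV[R]_n) ord0 j - ratr (b.1 ord0 j)| < ratr b.2]); last first.
    by apply/seteqP; split => t /= bt j; [move=> _|]; exact: bt.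
  apply: fin_bigcap_measurable => // j _.
  have mg : measurable_fun setT
      (fun t => `|(f t : 'rV[R]_n) ord0 j - ratr (b.1 ord0 j)|).
    by apply: measurableT_comp => //; apply: measurable_funB => //; exact: fj.
  have /= := mg measurableT `]-oo, ratr b.2[%classic (measurable_itv _).
  by rewrite setTI; congr measurable; apply/seteqP; split => t /=;
    rewrite in_itv.
apply/seteqP; split => t /=.
  move=> Ut.
  pose y : 'rV[R]_n := f t.
  have : nbhs y U by exact: open_nbhs_nbhs.
  case/(@nbhs_ballP R 'rV[R]_n y U) => e /= e0 eU.
  (* Half the radius: both [f t] and the point compared with it lie within [r]
     of the rational centre. *)
  have [r /andP[]] : exists r : rat, (0 < ratr r :> R) && (ratr r < e / 2).
    have [|r rin] := @rat_in_itvoo R 0 (e / 2); first by rewrite divr_gt0.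
    by exists r; move: rin; rewrite in_itv.
  move=> r0 re.
  have : forall j, exists q : rat,
      `|(f t : 'rV[R]_n) ord0 j - ratr q| < ratr r.
    move=> j; set z := (f t : 'rV[R]_n) ord0 j.
    have [|q] := @rat_in_itvoo R (z - ratr r) (z + ratr r); first by lra.
    rewrite in_itv /= => /andP[q1 q2]; exists q.
    by rewrite ltr_norml; apply/andP; split; lra.
  move=> /choice[q qr].
  exists (\row_j q j, r) => //.
  rewrite ifT.
    by move=> j; rewrite mxE.
  apply/asboolP => s /= sb.
  apply: eU; split => //= i j.
  rewrite (ord1 i).
  have := sb j; have := qr j.
  rewrite /= mxE !ltr_norml => /andP[q1 q2] /andP[s1 s2].
  by rewrite /ball/= ltr_norml /y; apply/andP; split; lra.
by move=> [b _]; case: ifPn => // /asboolP; apply.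
Qed.

Lemma measurable_borel_rV_coord (R : realType) (n : nat) (j : 'I_n) :
  measurable_fun setT (fun x : borel_rV R n => (x : 'rV[R]_n) ord0 j).
Proof.
apply: (measurability _ (RGenOInfty.measurableE R)) => _ [_ [a ->] <-].
rewrite setTI; apply: sub_sigma_algebra.
apply: (@open_comp _ _ (fun x : 'rV[R]_n => x ord0 j)).
  by move=> x _; exact: coord_continuous.
exact: rray_open.
Qed.

Lemma measurable_mean_field (R : realType) (n N : nat) (d : measure_display)
    (T : measurableType d) (u : T -> 'I_N -> borel_rV R n) :
  (forall p, measurable_fun setT (u ^~ p)) ->
  measurable_fun setT (fun t => mean_field (u t) : borel_rV R n).
Proof.
move=> mu; apply: borel_rV_coordP => j.
rewrite (_ : (fun t => _) =
    fun t => N%:R^-1 * \sum_(p < N) (u t p : 'rV[R]_n) ord0 j); last first.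
  by apply/funext => t; rewrite /mean_field mxE summxE.
apply: measurable_funM => //; apply: measurable_sum => p.
exact: measurableT_comp (@measurable_borel_rV_coord R n j) (mu p).
Qed.

(** * Expectations and upper limits *)

(** The integral of a nonnegative function is the supremum of the integrals of
    the simple functions below it, and that supremum is monotone whether or not
    the functions are measurable. *)
Lemma ge0_le_integralT (R : realType) (d : measure_display)
    (T : measurableType d) (mu : {measure set T -> \bar R})
    (f g : T -> \bar R) :
  (forall t, 0 <= f t)%E -> (forall t, f t <= g t)%E ->
  (\int[mu]_t f t <= \int[mu]_t g t)%E.
Proof.
move=> f0 fg; have g0 t : (0 <= g t)%E by exact: le_trans (fg t).
rewrite !ge0_integralTE//; apply: ereal_sup_le => _ [h hf <-].
by exists h => //= t; exact: le_trans (hf t) (fg t).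
Qed.

Lemma le_integralT (R : realType) (d : measure_display) (T : measurableType d)
    (mu : {measure set T -> \bar R}) (f g : T -> \bar R) :
  (forall t, f t <= g t)%E -> (\int[mu]_t f t <= \int[mu]_t g t)%E.
Proof.
move=> fg; rewrite integralE [leRHS]integralE.
apply: leeB; apply: ge0_le_integralT => // t.
- by apply: (@funepos_le _ _ setT); rewrite ?inE.
- by apply: (@funeneg_le _ _ setT); rewrite ?inE.
Qed.

(** [D] stands for the variational term, of which only the pointwise bound is
    known: its integral is compared with that of [X - Y] by monotonicity, and
    linearity is used for [X - Y] alone. *)
Lemma expectation_le_sub (R : realType) (d : measure_display)
    (T : measurableType d) (P : probability T R) (X Y D : T -> R) :
  measurable_fun setT X -> measurable_fun setT Y ->
  (forall t, 0 <= X t) -> (forall t, 0 <= Y t) ->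
  ('E_P[X] < +oo)%E -> ('E_P[Y] < +oo)%E ->
  (forall t, Y t + D t <= X t) ->
  ('E_P[D] <= 'E_P[X] - 'E_P[Y])%E.
Proof.
move=> mX mY X0 Y0 + + DXY; rewrite unlock => EX EY.
have int (Z : T -> R) : measurable_fun setT Z -> (forall t, 0 <= Z t) ->
    (\int[P]_t (Z t)%:E < +oo)%E -> P.-integrable setT (EFin \o Z).
  move=> mZ Z0 EZ; apply/integrableP; split; first exact/measurable_EFinP.
  by under eq_integral do rewrite /= ger0_norm//.
rewrite -integralB_EFin//; [|exact: int..].
by apply: le_integralT => t; rewrite -EFinB lee_fin lerBrDl.
Qed.

Lemma limn_esup_lt (R : realType) (u : (\bar R)^nat) (l : \bar R) :
  (limn_esup u < l)%E ->
  exists2 M : \bar R, (M < l)%E & \forall N \near \oo, (u N <= M)%E.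
Proof.
move=> /ereal_inf_lt[_ [V Voo <-] Vl]; exists (ereal_sup (u @` V)) => //.
by apply: filterS Voo => N VN; apply: ereal_sup_ubound; exists N.
Qed.

(** If [limn_esup b] were smaller than [l], then [b - a], hence [e], would
    eventually stay below a negative constant. *)
Lemma le_limn_esup_of_variation (R : realType) (a b e : (\bar R)^nat) (l : R) :
  a @ \oo --> l%:E -> (0 <= limn_esup e)%E ->
  (\forall N \near \oo, (e N <= b N - a N)%E) ->
  (l%:E <= limn_esup b)%E.
Proof.
move=> al e0 eab; rewrite leNgt; apply/negP => /limn_esup_lt[M Ml bM].
have [r Mr rl] : exists2 r : R, (M <= r%:E)%E & r < l.
  case: M Ml {bM} => [r||] //= Ml; first by exists r.
  by exists (l - 1); [rewrite leNye|lra].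
(* Eventually [b <= r] and [r' < a], so that [e <= r - r' < 0]. *)
pose r' := (r + l) / 2.
have ar' : \forall N \near \oo, (r'%:E < a N)%E.
  apply: (al (fun x => (r'%:E < x)%E)); apply: open_ereal_gt'.
  by rewrite lte_fin /r'; lra.
suff : (limn_esup e <= (r - r')%:E)%E.
  by move=> /(le_trans e0); rewrite lee_fin /r'; lra.
have : \forall N \near \oo, (e N <= (r - r')%:E)%E.
  near=> N; apply: (@le_trans _ _ (b N - a N)%E); first by near: N.
  rewrite EFinB; apply: leeB; last by apply: ltW; near: N.
  by apply: le_trans Mr; near: N.
move=> eN; apply: ge_ereal_inf.
exists (ereal_sup (e @` [set N | (e N <= (r - r')%:E)%E])).
  by exists [set N | (e N <= (r - r')%:E)%E].
by apply: ge_ereal_sup => _ [N eNr <-].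
Unshelve. all: by end_near. Qed.

(** * Costs of the N-agent problems *)

Section agent_problem.
Context (R : realType) (d : measure_display) (Omega : measurableType d)
  (P : probability Omega R) (d0 : measure_display) (Omega0 : measurableType d0)
  (n m : nat) (w0 : {RV P >-> Omega0}) (v : nat -> {RV P >-> borel_rV R m})
  (c : Omega0 -> 'rV[R]_n -> 'rV[R]_n -> R)
  (c_measurable : measurable_fun setT
     (fun z : Omega0 * borel_rV R n * borel_rV R n => c z.1.1 z.1.2 z.2))
  (c_ge0 : forall w x mu, 0 <= c w x mu).

Lemma measurable_agent_cost g (N : nat) (i : 'I_N) : policies g ->
  measurable_fun setT (fun t => agent_cost c (w0 t) i (actions v g t)).
Proof.
move=> mg.
have mu (p : 'I_N) :
    measurable_fun setT (fun t => actions v g t p : borel_rV R n).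
  by apply: measurableT_comp => //; exact: mg.
have mmean := @measurable_mean_field R n N d Omega (fun t => actions v g t) mu.
exact: (measurableT_comp c_measurable (measurable_fun_pair
  (measurable_fun_pair (measurable_funP w0) (mu i)) mmean)).
Qed.

Lemma J_N_sum g (N : nat) : policies g ->
  J_N w0 v c g N = ((N%:R^-1)%:E *
    \sum_(i < N) 'E_P[fun t => agent_cost c (w0 t) i (actions v g t)])%E.
Proof.
move=> mg; rewrite /J_N unlock; congr (_ * _)%E.
rewrite -ge0_integral_sum//.
- by apply: eq_integral => t _; rewrite sumEFin.
- by move=> i; apply/measurable_EFinP; exact: measurable_agent_cost.
- by move=> i t _; rewrite lee_fin c_ge0.
Qed.

Lemma expectation_total_cost_lty g (N : nat) : (0 < N)%N ->
  (J_N w0 v c g N < +oo)%E ->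
  ('E_P[fun t => (\sum_(i < N) agent_cost c (w0 t) i (actions v g t))%R]
    < +oo)%E.
Proof.
move=> N0; rewrite /J_N !ltey; apply: contraNN => /eqP ->.
by rewrite gt0_muley// lte_fin invr_gt0 ltr0n.
Qed.

Lemma J_N_ge0 g (N : nat) : (0 <= J_N w0 v c g N)%E.
Proof.
apply: mule_ge0; first by rewrite lee_fin invr_ge0.
by apply: expectation_ge0 => t; apply: sumr_ge0 => i _; exact: c_ge0.
Qed.

(** The tangent inequality summed over the agents and averaged. Both costs must
    be finite for the expectation of their difference to split. *)
Lemma J_N_variation (g gs : nat -> borel_rV R m -> borel_rV R n) (N : nat) :
  (forall w, [/\ jointly_convex c w, totally_differentiable c w
                & continuous_partials c w]) ->
  policies g -> policies gs -> (0 < N)%N ->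
  (J_N w0 v c g N < +oo)%E -> (J_N w0 v c gs N < +oo)%E ->
  ((N%:R^-1)%:E * 'E_P[fun t => (\sum_(i < N) \sum_(k < N)
      agent_cost_deriv c (w0 t) i k (actions v gs t)
        (actions v g t k - actions v gs t k))%R]
    <= J_N w0 v c g N - J_N w0 v c gs N)%E.
Proof.
move=> cw mg mgs N0 Jg Jgs.
have Eg := expectation_total_cost_lty g N N0 Jg.
have Egs := expectation_total_cost_lty gs N N0 Jgs.
have S0 h t : 0 <= \sum_(i < N) agent_cost c (w0 t) i (actions v h t).
  by apply: sumr_ge0 => i _; exact: c_ge0.
rewrite /J_N -muleBr//; last first.
  rewrite fin_num_adde_defl// fin_numN ge0_fin_numE//.
  by apply: expectation_ge0; exact: S0.
apply: lee_wpmul2l; first by rewrite lee_fin invr_ge0.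
apply: expectation_le_sub => //.
- by apply: measurable_sum => i; exact: measurable_agent_cost.
- by apply: measurable_sum => i; exact: measurable_agent_cost.
move=> t; rewrite -big_split; apply: ler_sum => i _.
by have [cconv cdiff cpart] := cw (w0 t); exact: agent_cost_first_order.
Qed.

End agent_problem.

Theorem theorem4 (R : realType)
    (d : measure_display) (Omega : measurableType d) (P : probability Omega R)
    (d0 : measure_display) (Omega0 : measurableType d0)
    (n m : nat) (hn : (0 < n)%N) (hm : (0 < m)%N)
    (w0 : {RV P >-> Omega0}) (v : nat -> {RV P >-> borel_rV R m})
    (c : Omega0 -> 'rV[R]_n -> 'rV[R]_n -> R)
    (c_measurable : measurable_fun setT
       (fun z : Omega0 * borel_rV R n * borel_rV R n => c z.1.1 z.1.2 z.2))
    (A1 : forall w : Omega0,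
       [/\ forall x mu : 'rV[R]_n, 0 <= c w x mu,
           jointly_convex c w,
           totally_differentiable c w
         & continuous_partials c w])
    (gs : nat -> borel_rV R m -> borel_rV R n)
    (gs_policy : policies gs)
    (A2 : let a := fun N : nat => ((N%:R^-1)%:E *
            \sum_(i < N) 'E_P[fun t => agent_cost c (w0 t) i (actions v gs t)])%E
          in cvgn a /\ (limn a < +oo)%E)
    (variational : forall g : nat -> borel_rV R m -> borel_rV R n,
       policies g -> (J w0 v c g < +oo)%E ->
       (0 <= limn_esup (fun N : nat => (N%:R^-1)%:E *
          'E_P[fun t => (\sum_(i < N) \sum_(k < N)
             agent_cost_deriv c (w0 t) i k (actions v gs t)
               (actions v g t k - actions v gs t k))%R]))%E) :
  globally_optimal w0 v c gs.
Proof.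
have c_ge0 w x mu : 0 <= c w x mu by have [] := A1 w.
have cw w : [/\ jointly_convex c w, totally_differentiable c w
    & continuous_partials c w] by have [] := A1 w.
case: A2 => /= Jcvg Jfin.
have JE : J_N w0 v c gs = fun N : nat => ((N%:R^-1)%:E *
    \sum_(i < N) 'E_P[fun t => agent_cost c (w0 t) i (actions v gs t)])%E.
  by apply/funext => N; exact: J_N_sum.
rewrite -JE in Jcvg Jfin.
have [l Jl] : exists l, limn (J_N w0 v c gs) = l%:E.
  exists (fine (limn (J_N w0 v c gs))); rewrite fineK// ge0_fin_numE//.
  by apply: lime_ge => //; apply: nearW => N; exact: J_N_ge0.
have Jgs : J w0 v c gs = l%:E by rewrite /J is_cvg_limn_esupE.
have Jgs_cvg : J_N w0 v c gs @ \oo --> l%:E by rewrite -Jl.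
split => //; apply/eqP; rewrite eq_le; apply/andP; split; last first.
  by apply: ereal_inf_lbound; exists gs.
apply: le_ereal_inf_tmp => _ [g mg <-]; rewrite Jgs.
have [->|] := eqVneq (J w0 v c g) +oo%E; first exact: leey.
rewrite -ltey => Jg.
apply: le_limn_esup_of_variation Jgs_cvg (variational g mg Jg) _.
have near_fin h : (J w0 v c h < +oo)%E ->
    \forall N \near \oo, (J_N w0 v c h N < +oo)%E.
  move=> /limn_esup_lt[M Moo JM].
  by apply: filterS JM => N /le_lt_trans; exact.
near=> N; apply: J_N_variation => //; near: N.
- exact: nbhs_infty_gt.
- exact: near_fin.
- by apply: near_fin; rewrite Jgs ltry.
Unshelve. all: by end_near. Qed.
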